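(* Suppose $\mathcal{G}$ has exactly two connected components, $\mathcal{G}_1$ and $\mathcal{G}_2$. Then there exists $\epsilon_0>0$ such that for every $\epsilon$ with $0<\epsilon<\epsilon_0$, the matrix $M(\epsilon)$ is positive definite if and only if $$\left(\#\mathcal{E}_\mathcal{H}^{(\mathcal{G}_1,\mathcal{G}_2)}\right)^2<4\,\#\mathcal{E}_\mathcal{H}^{(\mathcal{G}_1)}\,\#\mathcal{E}_\mathcal{H}^{(\mathcal{G}_2)}.$$
   Context: Let $\mathcal{F}=\{\mathcal{V},\mathcal{E}\}$ be a simple undirected graph with $\mathcal{V}=\{1,\dots,n\}$. Let $\mathcal{G}=\{\mathcal{V},\mathcal{E}_\mathcal{G}\}$ and $\mathcal{H}=\{\mathcal{V},\mathcal{E}_\mathcal{H}\}$ be subgraphs of $\mathcal{F}$ on the same vertex set with $\mathcal{E}_\mathcal{G}\cap\mathcal{E}_\mathcal{H}=\emptyset$ and $\mathcal{E}_\mathcal{G}\cup\mathcal{E}_\mathcal{H}=\mathcal{E}$. For a real parameter $\epsilon>0$ define the symmetric $n\times n$ matrix $M(\epsilon)=L_\mathcal{G}+\epsilon A_\mathcal{H}$, where $L_\mathcal{G}$ is the Laplacian matrix of $\mathcal{G}$ (degree matrix minus adjacency matrix) and $A_\mathcal{H}$ is the $0/1$ adjacency matrix of $\mathcal{H}$. Notation: $\#\mathcal{E}_\mathcal{H}^{(\mathcal{G}_i)}$ is the number of edges of $\mathcal{H}$ joining two vertices of $\mathcal{G}_i$; $\#\mathcal{E}_\mathcal{H}^{(\mathcal{G}_1,\mathcal{G}_2)}$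 is the number of edges of $\mathcal{H}$ joining a vertex of $\mathcal{G}_1$ to a vertex of $\mathcal{G}_2$. *)

(* Defs.v *)
From mathcomp Require Import all_boot all_order all_algebra.

Set Implicit Arguments.
Unset Strict Implicit.
Unset Printing Implicit Defensive.

Import Order.TTheory GRing.Theory Num.Theory.
Local Open Scope ring_scope.

(* Simple undirected graph on the vertex set 'I_n = {0, ..., n-1}; an edge is
   an unordered pair of distinct vertices. *)
Record sgraph (n : nat) := SGraph {
  edges : {set {set 'I_n}};
  card_edge : forall e, e \in edges -> #|e| = 2%N }.

Definition subgraph n (G F : sgraph n) : bool := edges G \subset edges F.

(* Irreflexive: [set i; i] is a singleton, hence never an edge. *)
Definition adj n (G : sgraph n) : rel 'I_n :=
  fun i j => [set i; j] \in edges G.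

(* The vertex sets of the connected components. *)
Definition components n (G : sgraph n) : {set {set 'I_n}} :=
  equivalence_partition (connect (adj G)) [set: 'I_n].

Definition edges_within n (G : sgraph n) (V : {set 'I_n}) : {set {set 'I_n}} :=
  [set e in edges G | e \subset V].

Definition edges_between n (G : sgraph n) (V W : {set 'I_n}) :
    {set {set 'I_n}} :=
  [set e in edges G | [exists x in V, exists y in W, e == [set x; y]]].

Definition degree n (G : sgraph n) (i : 'I_n) : nat :=
  #|[set e in edges G | i \in e]|.

Definition adj_mx (R : pzRingType) n (G : sgraph n) : 'M[R]_n :=
  \matrix_(i, j) (adj G i j)%:R.

Definition deg_mx (R : pzRingType) n (G : sgraph n) : 'M[R]_n :=
  diag_mx (\row_i (degree G i)%:R).

Definition laplacian (R : pzRingType) n (G : sgraph n) : 'M[R]_n :=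
  deg_mx R G - adj_mx R G.

Definition posdefmx (R : numDomainType) n (A : 'M[R]_n) : Prop :=
  A^T = A /\ forall x : 'cV[R]_n, x != 0 -> 0 < (x^T *m A *m x) 0 0.

(* Main.v *)
(* Let S^2 be the sum of (x_i - x_j)^2 over adjacent ordered pairs of G, so that
   the Laplacian form is S^2 / 2. Along a path in a component, x varies by at
   most n S, so x is within n S of the function y equal to constants a and b on
   the two components. The form of A_H at y is the binary form
   q = 2 (h1 a^2 + h12 a b + h2 b^2), which is positive definite iff
   h12^2 < 4 h1 h2. If it is, q >= (|a| + |b|)^2 / (4 (h1 + h2)), and the error
   made in replacing x by y is absorbed by S^2 / 2 for small epsilon. Conversely,
   the Laplacian form vanishes at y, so M(epsilon) > 0 forces q > 0. *)
Require Import Defs.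
From mathcomp Require Import all_boot all_order all_algebra reals.
From mathcomp Require Import ring lra.

Set Implicit Arguments.
Unset Strict Implicit.
Unset Printing Implicit Defensive.

Import Order.TTheory GRing.Theory Num.Theory.
Local Open Scope ring_scope.

(** * Edge counts as sums of adjacencies, and the partition into two components *)

Section Counting.
Variables (n : nat) (G : sgraph n).
Implicit Types (i j : 'I_n) (V W : {set 'I_n}).

Lemma adj_sym : symmetric (adj G).
Proof. by move=> i j; rewrite /adj setUC. Qed.

Lemma adj_irrefl : irreflexive (adj G).
Proof.
move=> i; apply/negP => /card_edge.
by rewrite setUid cards1.
Qed.

Lemma connect_adj_sym : connect_sym (adj G).
Proof. exact: sym_connect_sym adj_sym. Qed.

Lemma edge_incident e i :
  e \in edges G -> i \in e -> exists2 j, j != i & e = [set i; j].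
Proof.
move=> /card_edge /eqP /cards2P [a [b [neq_ab ->]]].
rewrite in_set2 => /orP[] /eqP ->.
- by exists b; rewrite // eq_sym.
- by exists a; rewrite // setUC.
Qed.

(** The map [j |-> [set i; j]] is a bijection from the neighbours of [i] in [V] onto the edges
    within [V] that contain [i]. *)
Lemma sum_adj_within V i : i \in V ->
  (\sum_(j in V) adj G i j)%N = #|[set e in edges_within G V | i \in e]|.
Proof.
move=> iV; rewrite -big_mkcondr /= sum1dep_card.
rewrite -(@card_in_imset _ _ (fun j => [set i; j])).
- apply: eq_card => e; apply/imsetP/idP.
  + move=> [j]; rewrite !inE => /andP[jV aij] ->.
    by rewrite [_ \in edges G]aij subUset !sub1set iV jV set21.
  + rewrite !inE => /andP[/andP[eG eV] ie].
    have [j _ def_e] := edge_incident eG ie; exists j => //.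
    rewrite !inE /adj -def_e eG andbT (subsetP eV) // def_e.
    by rewrite !inE eqxx orbT.
(* Injectivity: [j] lies in [[set i; k]], and [j = i] would be a loop. *)
- move=> j k; rewrite !inE => /andP[_ aij] _ /setP/(_ j).
  rewrite !inE eqxx orbT => /esym/orP[] /eqP // eq_ji.
  by rewrite eq_ji adj_irrefl in aij.
Qed.

Lemma edges_within_setT : edges_within G setT = edges G.
Proof. by apply/setP => e; rewrite !inE subsetT andbT. Qed.

Lemma sum_adj_degree i : (\sum_j adj G i j)%N = degree G i.
Proof.
rewrite /degree -[in RHS]edges_within_setT -sum_adj_within ?inE //.
by apply: eq_bigl => j; rewrite inE.
Qed.

(** Double counting of incidences: exchanging the sums counts each edge once per endpoint. *)
Lemma sum_adj_edges_within V :
  (\sum_(i in V) \sum_(j in V) adj G i j)%N = (2 * #|edges_within G V|)%N.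
Proof.
under eq_bigr => i iV do rewrite sum_adj_within // -sum1dep_card big_mkcondr.
rewrite exchange_big /= mulnC -sum_nat_const; apply: eq_bigr => e.
rewrite inE => /andP[eG eV].
rewrite -big_mkcondr sum1dep_card -(card_edge eG).
apply: eq_card => i; rewrite !inE.
by case ie: (i \in e); rewrite ?andbF ?andbT // (subsetP eV).
Qed.

(** No factor 2 here: disjointness determines which endpoint lies in [V], so each edge comes from
    exactly one pair. *)
Lemma sum_adj_edges_between V W : [disjoint V & W] ->
  (\sum_(i in V) \sum_(j in W) adj G i j)%N = #|edges_between G V W|.
Proof.
move=> dVW; rewrite pair_big_dep /= -big_mkcondr sum1dep_card.
rewrite -(@card_in_imset _ _ (fun p => [set p.1; p.2])).
- apply: eq_card => e; apply/imsetP/idP.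
  + move=> [[i j]]; rewrite !inE /= => /andP[/andP[iV jW] aij] ->.
    rewrite [_ \in edges G]aij /=.
    by apply/exists_inP; exists i => //; apply/exists_inP; exists j.
  + rewrite inE => /andP[eG] /exists_inP[i iV] /exists_inP[j jW] /eqP def_e.
    by exists (i, j); rewrite // !inE /= iV jW /adj -def_e.
- have notW i : i \in V -> i \in W = false.
    by move=> iV; apply: disjointFr dVW iV.
  move=> [i j] [k l]; rewrite !inE /= => /andP[/andP[iV jW] _].
  move=> /andP[/andP[kV lW] _] /setP eq_e; congr pair.
  + have := eq_e i; rewrite !inE eqxx => /esym/orP[] /eqP // eq_il.
    by rewrite -eq_il notW in lW.
  + have := eq_e j; rewrite !inE eqxx orbT => /esym/orP[] /eqP // eq_jk.
    by rewrite eq_jk notW in jW.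
Qed.

Variables V1 V2 : {set 'I_n}.
Hypothesis comp_G : components G = [set V1; V2].

Let connect_equiv :
  {in [set: 'I_n] & &, equivalence_rel (connect (adj G))}.
Proof.
move=> i j k _ _ _; split=> [|ij]; first exact: connect0.
exact: (same_connect connect_adj_sym ij).
Qed.

Let partG : partition [set V1; V2] [set: 'I_n].
Proof. by rewrite -comp_G; apply: equivalence_partitionP. Qed.

Let pblockG i j : (j \in pblock [set V1; V2] i) = connect (adj G) i j.
Proof. by rewrite -comp_G pblock_equivalence_partition ?inE. Qed.

Lemma components2_nonempty V : V \in [set V1; V2] -> exists i, i \in V.
Proof.
move=> VP; have /and3P[_ _ P0] := partG.
by apply/set0Pn; apply: contraNneq P0 => <-.
Qed.

Lemma components2_cover : V1 :|: V2 = setT.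
Proof.
have /and3P[/eqP <- _ _] := partG.
by rewrite /cover bigcup_setU !big_set1.
Qed.

Lemma components2_disjoint : V1 != V2 -> [disjoint V1 & V2].
Proof.
have /and3P[_ /trivIsetP tI _] := partG.
by apply: tI; rewrite !inE eqxx ?orbT.
Qed.

Lemma components2_connect V i j :
  V \in [set V1; V2] -> i \in V -> (j \in V) = connect (adj G) i j.
Proof.
move=> VP iV; have /and3P[_ tI _] := partG.
by rewrite -pblockG (def_pblock tI VP iV).
Qed.

End Counting.

(** * The Laplacian and adjacency quadratic forms, with their estimates *)

Section QuadraticForms.
Variable R : rcfType.
Variable n : nat.
Implicit Types (G H : sgraph n) (x y : 'I_n -> R).

Definition adj_form H x : R := \sum_i \sum_j (adj H i j)%:R * (x i * x j).

Definition dirichlet G x : R := \sum_i \sum_j (adj G i j)%:R * (x i - x j) ^+ 2.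

Lemma quad_formE (A : 'M[R]_n) (x : 'cV[R]_n) :
  (x^T *m A *m x) 0 0 = \sum_i \sum_j A i j * (x i 0 * x j 0).
Proof.
rewrite !mxE exchange_big; apply: eq_bigr => j _.
rewrite !mxE mulr_suml; apply: eq_bigr => i _; rewrite !mxE; ring.
Qed.

(** Expanding the squares in [dirichlet] gives, by symmetry of adjacency, the degree part [D] twice
    and minus twice the adjacency part [B]. *)
Lemma quad_laplacian G (x : 'cV[R]_n) :
  (x^T *m laplacian R G *m x) 0 0 = dirichlet G (fun i => x i 0) / 2.
Proof.
pose D := \sum_i \sum_j (adj G i j)%:R * x i 0 ^+ 2.
pose B := adj_form G (fun i => x i 0).
have -> : dirichlet G (fun i => x i 0) = D + D - B *+ 2.
  rewrite {2}/D exchange_big -big_split /= -sumrMnl -sumrB.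
  apply: eq_bigr => i _; rewrite -big_split /= -sumrMnl -sumrB.
  by apply: eq_bigr => j _; rewrite (adj_sym G j i); ring.
have -> : (x^T *m laplacian R G *m x) 0 0 = D - B; last by field.
rewrite quad_formE -sumrB; apply: eq_bigr => i _; rewrite -mulr_suml.
under eq_bigr => j _ do rewrite !mxE mulrBl.
rewrite sumrB; congr (_ - _).
rewrite (bigD1 i) //= big1 ?addr0 => [|j ne_ji]; last first.
  by rewrite eq_sym (negPf ne_ji) mulr0n mul0r.
by rewrite eqxx mulr1n -sum_adj_degree natr_sum expr2.
Qed.

Lemma quad_perturbed G H (eps : R) (x : 'cV[R]_n) :
  (x^T *m (laplacian R G + eps *: adj_mx R H) *m x) 0 0
  = dirichlet G (fun i => x i 0) / 2 + eps * adj_form H (fun i => x i 0).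
Proof.
rewrite mulmxDr mulmxDl mxE quad_laplacian -scalemxAr -scalemxAl mxE.
congr (_ + _ * _); rewrite quad_formE; apply: eq_bigr => i _.
by apply: eq_bigr => j _; rewrite mxE.
Qed.

Lemma tr_perturbed G H (eps : R) :
  (laplacian R G + eps *: adj_mx R H)^T = laplacian R G + eps *: adj_mx R H.
Proof.
apply/matrixP => i j; rewrite !mxE adj_sym (adj_sym H j i).
by case: eqVneq => [->|].
Qed.

Lemma dirichlet_ge0 G x : 0 <= dirichlet G x.
Proof. by do 2!apply: sumr_ge0 => ? _; rewrite mulr_ge0 ?ler0n ?sqr_ge0. Qed.

Lemma adj_dist_le G x i j :
  adj G i j -> `|x i - x j| <= Num.sqrt (dirichlet G x).
Proof.
move=> aij; rewrite -sqrtr_sqr ler_wsqrtr // /dirichlet (bigD1 i) //=.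
rewrite (bigD1 j) //= aij mul1r -addrA lerDl addr_ge0 //.
  by apply: sumr_ge0 => ? _; rewrite mulr_ge0 ?ler0n ?sqr_ge0.
by do 2!apply: sumr_ge0 => ? _; rewrite mulr_ge0 ?ler0n ?sqr_ge0.
Qed.

(* A discrete Poincare inequality: a simple path has fewer than [n] edges. *)
Lemma connect_dist_le G x i j : connect (adj G) i j ->
  `|x i - x j| <= n%:R * Num.sqrt (dirichlet G x).
Proof.
move=> /connectP[p0 pG0 ->]; case/shortenP: pG0 => p pG p_uniq _.
have : (size p <= n)%N.
  by have /card_uniqP := p_uniq; have := max_card (mem (i :: p));
     rewrite card_ord /= => le_n eq_sz; rewrite eq_sz /= in le_n; exact: ltnW.
move=> le_pn; apply: (@le_trans _ _ ((size p)%:R * Num.sqrt (dirichlet G x))).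
  elim: p i pG {p_uniq le_pn} => [|k p IHp] i /=.
    by rewrite subrr normr0 mul0r.
  move=> /andP[aik /IHp le_k]; rewrite -natr1 mulrDl mul1r [leRHS]addrC.
  apply: le_trans (ler_distD (x k) _ _) _.
  by rewrite lerD // adj_dist_le.
by rewrite ler_wpM2r ?sqrtr_ge0 // ler_nat.
Qed.

(** Each of the [n ^ 2] terms changes by at most [2 * t * d + d ^ 2], since [x i * x j - y i * y j]
    is linear plus quadratic in [x - y]. *)
Lemma adj_form_dist H x y (t d : R) :
    (forall i, `|y i| <= t) -> (forall i, `|x i - y i| <= d) ->
  `|adj_form H x - adj_form H y| <= n%:R ^+ 2 * (2 * t * d + d ^+ 2).
Proof.
move=> yt xyd; rewrite -sumrB.
have sum_le (f : 'I_n -> R) (c : R) :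
    (forall i, `|f i| <= c) -> `|\sum_i f i| <= n%:R * c.
  move=> fc; apply: le_trans (ler_norm_sum _ _ _) _.
  apply: le_trans (ler_sum _ (fun i _ => fc i)) _.
  by rewrite sumr_const card_ord mulr_natl.
rewrite expr2 -mulrA; apply: (sum_le) => i; rewrite -sumrB.
apply: (sum_le) => j; rewrite -mulrBr normrM.
have -> : x i * x j - y i * y j = y i * (x j - y j) + (x i - y i) * y j
    + (x i - y i) * (x j - y j) by ring.
apply: (@le_trans _ _ (t * d + d * t + d * d)); last by lra.
apply: (@le_trans _ _
  (1 * `|y i * (x j - y j) + (x i - y i) * y j + (x i - y i) * (x j - y j)|)).
  by rewrite ler_wpM2r // normr_nat lern1 leq_b1.
rewrite mul1r; apply: le_trans (ler_normD _ _) _; rewrite lerD //.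
  by apply: le_trans (ler_normD _ _) _; rewrite lerD // normrM ler_pM.
by rewrite normrM ler_pM.
Qed.

End QuadraticForms.

Definition two_valued (T : Type) n (V : {set 'I_n}) (a b : T) (i : 'I_n) : T :=
  if i \in V then a else b.

(* Young's inequality splits the cross term [2 m^3 t S] into [t^2 / (2 k)] and
   [2 m^6 k S^2]. *)
Lemma perturbation_gt0 (R : realFieldType) (m k t S eps q p : R) :
    0 < k -> 0 < eps -> 2 * eps * (m ^+ 4 + 2 * m ^+ 6 * k) < 1 ->
    0 <= t -> 0 <= S -> (0 < t) || (0 < S) ->
    t ^+ 2 <= k * q -> q - m ^+ 2 * (2 * t * (m * S) + (m * S) ^+ 2) <= p ->
  0 < S ^+ 2 / 2 + eps * p.
Proof.
move=> k_gt0 eps_gt0 eps_lt t_ge0 S_ge0 tS tq pq.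
have young : 2 * m ^+ 3 * t * S <= t ^+ 2 / (2 * k) + 2 * m ^+ 6 * k * S ^+ 2.
  rewrite -subr_ge0.
  have -> : t ^+ 2 / (2 * k) + 2 * m ^+ 6 * k * S ^+ 2 - 2 * m ^+ 3 * t * S
    = (t - 2 * k * m ^+ 3 * S) ^+ 2 / (2 * k) by field; rewrite gt_eqF.
  by rewrite divr_ge0 ?sqr_ge0 // mulr_ge0 // ltW.
have q_ge : t ^+ 2 / k <= q by rewrite ler_pdivrMr // mulrC.
have p_ge : t ^+ 2 / (2 * k) - (m ^+ 4 + 2 * m ^+ 6 * k) * S ^+ 2 <= p.
  have halves : t ^+ 2 / k = t ^+ 2 / (2 * k) + t ^+ 2 / (2 * k).
    by field; rewrite gt_eqF.
  have expand : m ^+ 2 * (2 * t * (m * S) + (m * S) ^+ 2)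
    = 2 * m ^+ 3 * t * S + m ^+ 4 * S ^+ 2 by ring.
  rewrite expand in pq; lra.
(* What remains of the coefficient 1/2 of [S ^+ 2] after absorbing the error; it is positive by the
   smallness of [eps]. *)
pose c := (1 - 2 * eps * (m ^+ 4 + 2 * m ^+ 6 * k)) / 2.
have c_gt0 : 0 < c by rewrite /c; lra.
apply: (@lt_le_trans _ _ (c * S ^+ 2 + eps * (t ^+ 2 / (2 * k)))); last first.
  have := ler_wpM2l (ltW eps_gt0) p_ge; rewrite /c; lra.
have k2_gt0 : 0 < 2 * k by rewrite mulr_gt0.
case/orP: tS => [t_gt0 | S_gt0].
  apply: ltr_wpDl; first by rewrite mulr_ge0 ?exprn_ge0 ?(ltW c_gt0).
  by rewrite pmulr_rgt0 ?divr_gt0 ?exprn_gt0.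
apply: ltr_wpDr; last by rewrite pmulr_rgt0 ?exprn_gt0.
by rewrite mulr_ge0 ?(ltW eps_gt0) // divr_ge0 ?exprn_ge0 // ltW.
Qed.

(** * The binary form on the kernel of the Laplacian, and both implications *)

Section TwoComponents.
Variables (R : rcfType) (n : nat) (G H : sgraph n) (V1 V2 : {set 'I_n}).
Hypothesis comp_G : components G = [set V1; V2].
Hypothesis neq_V12 : V1 != V2.

Let h1 : R := #|edges_within H V1|%:R.
Let h2 : R := #|edges_within H V2|%:R.
Let h12 : R := #|edges_between H V1 V2|%:R.

Let notin_V1 i : (i \notin V1) = (i \in V2).
Proof.
have := in_setT i; rewrite -(components2_cover comp_G) inE.
have [iV1|//] := boolP (i \in V1); move=> _; apply/esym.
exact: disjointFr (components2_disjoint comp_G neq_V12) iV1.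
Qed.

Lemma dirichlet_two_valued (a b : R) : dirichlet G (two_valued V1 a b) = 0.
Proof.
apply: big1 => i _; apply: big1 => j _.
have [aij|] := boolP (adj G i j); last by rewrite mul0r.
rewrite /two_valued; suff -> : (i \in V1) = (j \in V1) by rewrite subrr expr0n mulr0.
have V1P : V1 \in [set V1; V2] by rewrite !inE eqxx.
apply/idP/idP => [iV|jV].
  by rewrite (components2_connect comp_G _ V1P iV) connect1.
by rewrite (components2_connect comp_G _ V1P jV) connect1 // adj_sym.
Qed.

(** The double sum splits into four blocks with constant products: the diagonal ones contribute
    [2 * h1] and [2 * h2], the two mixed ones [h12] each. *)
Lemma adj_form_two_valued (a b : R) : adj_form H (two_valued V1 a b)
  = 2 * (h1 * a ^+ 2 + h12 * (a * b) + h2 * b ^+ 2).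
Proof.
pose s (V W : {set 'I_n}) : R := \sum_(i in V) \sum_(j in W) (adj H i j)%:R.
have sE V W : s V W = (\sum_(i in V) \sum_(j in W) adj H i j)%N%:R.
  by rewrite natr_sum; apply: eq_bigr => i _; rewrite natr_sum.
have s11 : s V1 V1 = 2 * h1 by rewrite sE sum_adj_edges_within natrM.
have s22 : s V2 V2 = 2 * h2 by rewrite sE sum_adj_edges_within natrM.
have s12 : s V1 V2 = h12.
  by rewrite sE sum_adj_edges_between // (components2_disjoint comp_G).
have s21 : s V2 V1 = h12.
  rewrite -s12 /s exchange_big; apply: eq_bigr => i _.
  by apply: eq_bigr => j _; rewrite adj_sym.
have split_sum (f : 'I_n -> R) :
    \sum_i f i = \sum_(i in V1) f i + \sum_(i in V2) f i.
  rewrite (bigID (mem V1)) /=; congr (_ + _).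
  by apply: eq_bigl => i; rewrite notin_V1.
have valE V c : (V == V1) && (c == a) || (V == V2) && (c == b) ->
    {in V, forall i, two_valued V1 a b i = c}.
  move=> /orP[] /andP[/eqP-> /eqP->] i iV; rewrite /two_valued ?iV //.
  by rewrite -notin_V1 in iV; rewrite (negPf iV).
have sum_const V W c d : (V == V1) && (c == a) || (V == V2) && (c == b) ->
    (W == V1) && (d == a) || (W == V2) && (d == b) ->
  \sum_(i in V) \sum_(j in W)
     (adj H i j)%:R * (two_valued V1 a b i * two_valued V1 a b j) = s V W * (c * d).
  move=> Vc Wd; rewrite /s mulr_suml; apply: eq_bigr => i iV.
  rewrite mulr_suml; apply: eq_bigr => j jW.
  by rewrite (valE V c) // (valE W d).
rewrite /adj_form split_sum.
under eq_bigr => i _ do rewrite split_sum.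
under [X in _ + X]eq_bigr => i _ do rewrite split_sum.
rewrite !big_split /= (sum_const V1 V1 a a) ?(sum_const V1 V2 a b)
  ?(sum_const V2 V1 b a) ?(sum_const V2 V2 b b) ?eqxx ?orbT //.
rewrite s11 s12 s21 s22; ring.
Qed.

(* The kernel of the Laplacian is spanned by the indicators of the components;
   testing on [(1, 0)] and [(h12, - 2 h1)] gives the discriminant condition. *)
Lemma posdef_discriminant (eps : R) : 0 < eps ->
    posdefmx (laplacian R G + eps *: adj_mx R H) ->
  h12 ^+ 2 < 4 * h1 * h2.
Proof.
move=> eps0 [_ pos].
have q_gt0 a b : (a != 0) || (b != 0) ->
    0 < h1 * a ^+ 2 + h12 * (a * b) + h2 * b ^+ 2.
  move=> ab0; have := pos (\col_i two_valued V1 a b i).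
  rewrite quad_perturbed.
  have -> : dirichlet G (fun i => (\col_i two_valued V1 a b i) i 0) = 0.
    rewrite -(dirichlet_two_valued a b); apply: eq_bigr => i _.
    by apply: eq_bigr => j _; rewrite !mxE.
  have -> : adj_form H (fun i => (\col_i two_valued V1 a b i) i 0)
      = adj_form H (two_valued V1 a b).
    by apply: eq_bigr => i _; apply: eq_bigr => j _; rewrite !mxE.
  rewrite adj_form_two_valued mul0r add0r !pmulr_rgt0 //; apply.
  (* Both components are nonempty, so a nonzero pair [(a, b)] gives a nonzero vector. *)
  have [r1 r1V] : exists i, i \in V1.
    by apply: (components2_nonempty comp_G); rewrite !inE eqxx.
  have [r2] : exists i, i \in V2.
    by apply: (components2_nonempty comp_G); rewrite !inE eqxx orbT.
  rewrite -notin_V1 => r2V.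
  apply: contraTneq ab0 => /matrixP y0; rewrite negb_or !negbK.
  have := y0 r1 0; have := y0 r2 0; rewrite !mxE /two_valued r1V (negPf r2V).
  by move=> -> ->; rewrite eqxx.
have h1_gt0 : 0 < h1.
  by have := q_gt0 1 0; rewrite oner_eq0 => /(_ isT); lra.
have h1_neq0 : - (2 * h1) != 0 by rewrite lt_eqF // oppr_lt0 mulr_gt0.
have := q_gt0 h12 (- (2 * h1)); rewrite h1_neq0 orbT => /(_ isT).
have -> : h1 * h12 ^+ 2 + h12 * (h12 * - (2 * h1)) + h2 * (- (2 * h1)) ^+ 2
  = h1 * (4 * h1 * h2 - h12 ^+ 2) by ring.
by rewrite pmulr_rgt0 // subr_gt0.
Qed.

(* Integrality makes the discriminant gap at least [1], whence an explicit
   lower bound for the smallest eigenvalue of the binary form. *)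
Lemma binary_form_ge (a b : R) :
    (#|edges_between H V1 V2| ^ 2
       < 4 * #|edges_within H V1| * #|edges_within H V2|)%N ->
  (`|a| + `|b|) ^+ 2 <=
    4 * (h1 + h2) * (2 * (h1 * a ^+ 2 + h12 * (a * b) + h2 * b ^+ 2)).
Proof.
move=> disc; have gap : h12 ^+ 2 + 1 <= 4 * h1 * h2.
  by rewrite -natrX natr1 /h1 /h2 -!natrM ler_nat.
apply: (@le_trans _ _ (2 * (a ^+ 2 + b ^+ 2))).
  rewrite -(real_normK (num_real a)) -(real_normK (num_real b)).
  by have := sqr_ge0 (`|a| - `|b|); nra.
(* With q the binary form without its factor 2, completing the square gives 4 h1 q = (2 h1 a + h12
   b)^2 + (4 h1 h2 - h12^2) b^2 >= b^2, and symmetrically 4 h2 q >= a^2; the two are added. *)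
have := sqr_ge0 (2 * h1 * a + h12 * b); have := sqr_ge0 (2 * h2 * b + h12 * a).
have := ler_wpM2r (sqr_ge0 a) gap; have := ler_wpM2r (sqr_ge0 b) gap.
nra.
Qed.

Lemma discriminant_posdef (eps : R) :
    (#|edges_between H V1 V2| ^ 2
       < 4 * #|edges_within H V1| * #|edges_within H V2|)%N ->
    0 < eps ->
    2 * eps * (n%:R ^+ 4 + 2 * n%:R ^+ 6 * (4 * (h1 + h2))) < 1 ->
  posdefmx (laplacian R G + eps *: adj_mx R H).
Proof.
move=> disc eps_gt0 eps_lt; split=> [|x x_neq0]; first exact: tr_perturbed.
rewrite quad_perturbed; set f := fun i => x i 0.
have [r1 r1V] : exists i, i \in V1.
  by apply: (components2_nonempty comp_G); rewrite !inE eqxx.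
have [r2 r2V] : exists i, i \in V2.
  by apply: (components2_nonempty comp_G); rewrite !inE eqxx orbT.
(* The constants approximating [f] are its values at one representative per component. *)
pose a := f r1; pose b := f r2; pose t := `|a| + `|b|.
pose S := Num.sqrt (dirichlet G f); pose y := two_valued V1 a b.
have S_ge0 : 0 <= S by exact: sqrtr_ge0.
have fy i : `|f i - y i| <= n%:R * S.
  rewrite /y /two_valued; case: ifPn => [iV | ].
    apply: connect_dist_le; rewrite -(components2_connect comp_G r1 (V := V1)) //.
    by rewrite !inE eqxx.
  rewrite notin_V1 => iV; apply: connect_dist_le.
  rewrite -(components2_connect comp_G r2 (V := V2)) //.
  by rewrite !inE eqxx orbT.
have yt i : `|y i| <= t.
  by rewrite /y /two_valued /t; case: ifP; rewrite ?lerDl ?lerDr.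
have := adj_form_dist H yt fy; rewrite ler_distl => /andP[form_ge _].
have S2 : dirichlet G f = S ^+ 2 by rewrite sqr_sqrtr // dirichlet_ge0.
have q_ge := binary_form_ge a b disc.
rewrite -adj_form_two_valued -/y -/t in q_ge.
(* The strict inequality [disc] fails if [H] has no edge within either component. *)
have k_gt0 : 0 < h1 + h2.
  rewrite /h1 /h2 -natrD ltr0n lt0n addn_eq0; apply: contraTN disc.
  by case/andP=> /eqP->; rewrite muln0 mul0n.
(* If [t] and [S] both vanish, then [y = 0] and [f = y], so [x = 0]. *)
have tS_gt0 : (0 < t) || (0 < S).
  rewrite !lt_def S_ge0 andbT /t addr_ge0 // andbT -negb_and.
  apply: contraNN x_neq0 => /andP[/eqP t0 /eqP S0].
  apply/eqP/matrixP => i j; rewrite ord1 mxE.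
  have := yt i; rewrite /t t0 normr_le0 => /eqP yi0.
  by have := fy i; rewrite yi0 S0 mulr0 subr0 normr_le0 => /eqP.
rewrite -/f S2; apply: perturbation_gt0 q_ge form_ge => //.
- by rewrite mulr_gt0.
- exact: addr_ge0.
Qed.

End TwoComponents.

Theorem lemma2 (R : realType) (n : nat) (F G H : sgraph n)
    (sub_GF : subgraph G F) (sub_HF : subgraph H F)
    (disj_GH : edges G :&: edges H = set0)
    (union_GH : edges G :|: edges H = edges F)
    (V1 V2 : {set 'I_n})
    (comp_G : components G = [set V1; V2]) (neq_V12 : V1 != V2) :
  exists2 eps0 : R, 0 < eps0 &
    forall eps : R, 0 < eps < eps0 ->
      posdefmx (laplacian R G + eps *: adj_mx R H) <->
      (#|edges_between H V1 V2| ^ 2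
         < 4 * #|edges_within H V1| * #|edges_within H V2|)%N.
Proof.
pose h1 : R := #|edges_within H V1|%:R.
pose h2 : R := #|edges_within H V2|%:R.
pose C : R := n%:R ^+ 4 + 2 * n%:R ^+ 6 * (4 * (h1 + h2)).
have C_ge0 : 0 <= C by rewrite addr_ge0 ?mulr_ge0 ?addr_ge0 ?exprn_ge0 ?ler0n.
have C1_gt0 : 0 < 2 * C + 1 by lra.
(* Below this bound [2 * eps * C < 1]; adding 1 keeps the denominator positive knowing only
   [0 <= C]. *)
exists (2 * C + 1)^-1 => [|eps /andP[eps_gt0 eps_lt]]; first by rewrite invr_gt0.
split=> [posM | disc].
  have := posdef_discriminant comp_G neq_V12 eps_gt0 posM.
  by rewrite -natrX -!natrM ltr_nat.
apply: (discriminant_posdef comp_G neq_V12 disc eps_gt0).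
move: eps_lt; rewrite -(ltr_pM2r C1_gt0) mulVf ?gt_eqF // -/h1 -/h2 -/C; lra.
Qed.
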